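(* Let $\mathcal{H}$ be a separable complex Hilbert space, let $\{S_\gamma\}_{\gamma\in\Gamma}$ be a collection of finite-dimensional subspaces of $\mathcal{H}$ with $\Gamma$ an arbitrary index set, and put $\mathcal{X}:=\bigcup_{\gamma\in\Gamma}S_\gamma$ and $S_{\gamma,\theta}:=S_\gamma+S_\theta$ for $\gamma,\theta\in\Gamma$. Let $\Psi=\{\psi_i\}_{i\in I}$ be a Bessel sequence in $\mathcal{H}$ and, for every $\gamma,\theta\in\Gamma$, let $\Phi_{\gamma,\theta}$ be a Parseval frame for $S_{\gamma,\theta}$. Let $0<\alpha\le\beta<\infty$. Then $\Psi$ provides a stable sampling operator for $\mathcal{X}$ with constants $\alpha$ and $\beta$ if and only if (i) $\dim(\operatorname{range}(G_{\Phi_{\gamma,\theta},\Psi}))=\dim(S_{\gamma,\theta})$ for all $\gamma,\theta\in\Gamma$, and (ii) $\sigma^2(G_{\Phi_{\gamma,\theta},\Psi})\subseteq\{0\}\cup[\alpha,\beta]$ for all $\gamma,\theta\in\Gamma$.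
   Context: All index sets of sequences (such as $I$) are countable. A sequence $X=\{x_j\}_{j\in J}$ in a Hilbert space is a Bessel sequence if there is $0<\beta'<\infty$ with $\sum_j|\langle h,x_j\rangle|^2\le\beta'\|h\|^2$ for all $h$. It is a Parseval frame for a closed subspace $S$ if all $x_j\in S$ and $\sum_j|\langle h,x_j\rangle|^2=\|h\|^2$ for all $h\in S$. The sampling operator associated to $\Psi$ is $A:\mathcal{H}\to\ell^2(I)$, $Af=\{\langle f,\psi_i\rangle\}_{i\in I}$. It is stable on (for) a subset $T\subseteq\mathcal{H}$ with constants $\alpha,\beta$ if $\alpha\|x_1-x_2\|^2\le\|Ax_1-Ax_2\|^2_{\ell^2(I)}\le\beta\|x_1-x_2\|^2$ for all $x_1,x_2\in T$. For a Bessel sequence $X=\{x_j\}_{j\in J}$, the analysis operator is $B_X:\mathcal{H}\to\ell^2(J)$, $B_Xh=\{\langle h,x_j\rangle\}_j$, with adjoint (synthesis operator) $B_X^*c=\sum_jc_jx_j$. For Bessel sequences $X=\{x_j\}_{j\in J}$ and $Y=\{y_i\}_{i\in I}$ the cross-correlation operator is $G_{X,Y}:=B_YB_X^*:\ell^2(J)\to\ell^2(I)$, with matrix entries $(G_{X,Y})_{i,j}=\langle x_j,y_i\rangle$. For a bounded linear operator $W$ between Hilbert spaces, $\sigma^2(W):=\sigma(W^*W)$, the spectrum of $W^*W$. *)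

(* Defs.v *)
From HB Require Import structures.
From mathcomp Require Import all_boot all_order all_algebra.
From mathcomp Require Import all_classical all_reals all_analysis.
From mathcomp Require Import finmap sesquilinear complex ring lra.

Set Implicit Arguments.
Unset Strict Implicit.
Unset Printing Implicit Defensive.

Import Order.TTheory GRing.Theory Num.Theory.
Import numFieldNormedType.Exports.

Local Open Scope classical_set_scope.
Local Open Scope ring_scope.
Local Open Scope complex_scope.

(* The form [inner] is linear in its first argument and conjugate-linear in the
   second one. *)
HB.mixin Record NormedModule_isInnerProduct (C : numClosedFieldType) H
    & NormedModule C H := {
  inner : {dot H for (@Num.conj C)};
  sqr_normr_inner : forall x : H, `|x| ^+ 2 = inner x x
}.

#[short(type="innerProductType")]
HB.structure Definition InnerProduct (C : numClosedFieldType) :=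
  {H of NormedModule C H & NormedModule_isInnerProduct C H}.

#[short(type="hilbertType")]
HB.structure Definition Hilbert (C : numClosedFieldType) :=
  {H of InnerProduct C H & Complete H}.

(* Norms over R[i] take their values in R[i]; [sqnorm] is the squared norm as
   an element of R. *)
Definition sqnorm (R : realType) (V : normedZmodType R[i]) (x : V) : R :=
  complex.Re (`|x| ^+ 2).

Section sqnorm_theory.
Variable R : realType.

Lemma sqnormE (V : normedZmodType R[i]) (x : V) : (sqnorm x)%:C = `|x| ^+ 2.
Proof. by rewrite RRe_real// rpredX// normr_real. Qed.

Lemma sqnorm_ge0 (V : normedZmodType R[i]) (x : V) : 0 <= sqnorm x.
Proof. by rewrite -ler0c sqnormE exprn_ge0. Qed.

Lemma sqnormC (z : R[i]) : sqnorm z = complex.Re z ^+ 2 + complex.Im z ^+ 2.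
Proof. by rewrite /sqnorm -add_Re2_Im2. Qed.

Lemma conjCE (z : R[i]) : Num.conj z = z^*.
Proof.
have [->|z0] := eqVneq z 0; first by rewrite !rmorph0.
by apply: (mulfI z0); rewrite -normCK sqr_normc.
Qed.

Lemma normr_ltE (V : normedZmodType R[i]) (x : V) (e : R) : 0 <= e ->
  (`|x| < e%:C) = (sqnorm x < e ^+ 2).
Proof.
by move=> e0; rewrite -ltcR sqnormE rmorphXn/= ltr_pXn2r// nnegrE ?ler0c.
Qed.

Lemma normr_leE (V : normedZmodType R[i]) (x : V) (e : R) : 0 <= e ->
  (`|x| <= e%:C) = (sqnorm x <= e ^+ 2).
Proof.
by move=> e0; rewrite -lecR sqnormE rmorphXn/= ler_pXn2r// nnegrE ?ler0c.
Qed.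

End sqnorm_theory.

Section dot_norm.
Variables (C : numClosedFieldType) (U : lmodType C) (dot : {dot U for (@Num.conj C)}).

Lemma dot_CauchySchwarz (u v : U) : `|dot u v| ^+ 2 <= dot u u * dot v v.
Proof.
have [->|v0] := eqVneq v 0.
  by rewrite (linear0r dot u : _ = 0) normr0 expr0n mulr_ge0 ?dnorm_ge0.
have vv0 : 0 < dot v v by rewrite dnorm_gt0.
have := dnorm_ge0 dot (u - (dot u v / dot v v) *: v).
rewrite dnormB dnormZ linearZr_LR/= rmorphM/= fmorphV/=.
rewrite (CrealP (gtr0_real vv0)) !rmorphM/= fmorphV/= (CrealP (gtr0_real vv0)) conjCK.
rewrite normrM normfV (gtr0_norm vv0) exprMn normCK.
set a := dot u v; set w := dot v v => h.
rewrite -ler_pdivrMr// -subr_ge0; apply: le_trans h _.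
rewrite le_eqVlt; apply/orP; left; apply/eqP.
have w0 : w != 0 by rewrite gt_eqF.
by field.
Qed.

Lemma dot_triangle (u v : U) :
  sqrtC (dot (u + v) (u + v)) <= sqrtC (dot u u) + sqrtC (dot v v).
Proof.
have su := dnorm_ge0 dot u; have sv := dnorm_ge0 dot v.
rewrite -(@ler_pXn2r _ 2)// ?nnegrE ?addr_ge0 ?sqrtC_ge0 ?dnorm_ge0//.
rewrite sqrrD !sqrtCK dnormD addrAC lerD2r lerD2l.
have -> : dot u v + (dot u v)^*%R = 'Re (dot u v) *+ 2.
  by rewrite ReE -[RHS]mulr_natr divfK// pnatr_eq0.
rewrite lerMn2r/= (le_trans (leif_Re_Creal _).1)//.
rewrite -(@ler_pXn2r _ 2)// ?nnegrE ?mulr_ge0 ?sqrtC_ge0//.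
by rewrite exprMn !sqrtCK dot_CauchySchwarz.
Qed.

End dot_norm.

(* [rsum f] and [csum c] are the unconditional sums of the families [f] and
   [c]; they are meaningful only for absolutely summable families. *)
Section sums.
Variables (R : realType) (J : choiceType).
Implicit Types (f g h : J -> R) (c d : J -> R[i]).

Definition nsum f : R := fine (\esum_(j in [set: J]) (f j)%:E).

Definition rsum f : R :=
  nsum (fun j => Num.max (f j) 0) - nsum (fun j => Num.max (- f j) 0).

Definition csum c : R[i] :=
  rsum (fun j => complex.Re (c j)) +i* rsum (fun j => complex.Im (c j)).

Definition rsummable f := (\esum_(j in [set: J]) `|f j|%:E < +oo)%E.

Lemma ge0_rsummableE f : (forall j, 0 <= f j) ->
  rsummable f = (\esum_(j in [set: J]) (f j)%:E < +oo)%E.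
Proof.
by move=> f0; rewrite /rsummable; under eq_esum do rewrite ger0_norm//.
Qed.

Lemma le_rsummable g f : (forall j, `|f j| <= g j) -> rsummable g -> rsummable f.
Proof.
move=> fg; apply: le_lt_trans; apply: le_esum => j _ /=.
by rewrite lee_fin (le_trans (fg j))// ler_norm.
Qed.

Lemma rsummable0 : rsummable (fun=> 0).
Proof. by rewrite /rsummable esum1// => j _; rewrite normr0. Qed.

Lemma rsummableD f g : rsummable f -> rsummable g ->
  rsummable (fun j => f j + g j).
Proof.
move=> sf sg; apply: le_lt_trans (lte_add_pinfty sf sg).
rewrite -esumD; [|by move=> *; rewrite lee_fin..].
by apply: le_esum => j _; rewrite lee_fin ler_normD.
Qed.

Lemma nsum_ge0 f : (forall j, 0 <= f j) -> 0 <= nsum f.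
Proof.
by move=> f0; apply: fine_ge0; apply: esum_ge0 => j _; rewrite lee_fin.
Qed.

Lemma nsumK f : (forall j, 0 <= f j) -> rsummable f ->
  (nsum f)%:E = \esum_(j in [set: J]) (f j)%:E.
Proof.
move=> f0; rewrite ge0_rsummableE// => foo; rewrite fineK// ge0_fin_numE//.
by apply: esum_ge0 => j _; rewrite lee_fin.
Qed.

Lemma nsumD f g : (forall j, 0 <= f j) -> (forall j, 0 <= g j) ->
  rsummable f -> rsummable g -> nsum (fun j => f j + g j) = nsum f + nsum g.
Proof.
move=> f0 g0 sf sg; apply: EFin_inj; rewrite EFinD !nsumK//; last 2 first.
- by move=> j; rewrite addr_ge0.
- exact: rsummableD.
by under eq_esum do rewrite EFinD; rewrite esumD// => j _; rewrite lee_fin.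
Qed.

Lemma esumZ k f : 0 <= k -> (forall j, 0 <= f j) ->
  (\esum_(j in [set: J]) (k * f j)%:E = k%:E * \esum_(j in [set: J]) (f j)%:E)%E.
Proof.
move=> k0 f0; rewrite /esum -ereal_supZl//; last first.
  by apply/set0P; exists (\sum_(j \in set0) (f j)%:E)%E; exists set0.
congr ereal_sup; rewrite image_comp; apply: eq_imagel => A _ /=.
by rewrite ge0_mule_fsumr// => j; rewrite lee_fin.
Qed.

Lemma rsummableZ k f : rsummable f -> rsummable (fun j => k * f j).
Proof.
rewrite /rsummable => foo; under eq_esum do rewrite normrM.
by rewrite esumZ//; apply: lte_mul_pinfty => //; rewrite lee_fin.
Qed.

Lemma nsumZ k f : 0 <= k -> (forall j, 0 <= f j) ->
  nsum (fun j => k * f j) = k * nsum f.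
Proof.
move=> k0 f0; rewrite /nsum esumZ//.
have: (0 <= \esum_(j in [set: J]) (f j)%:E)%E.
  by apply: esum_ge0 => j _; rewrite lee_fin.
case: (\esum_(j in _) _)%E => [r|_|]//=; rewrite mulr0.
have [->|k1] := eqVneq k 0; first by rewrite mul0e.
by rewrite gt0_muley// lte_fin lt0r k1.
Qed.

Let pos_ge0 f j : 0 <= Num.max (f j) 0.
Proof. by rewrite le_max lexx orbT. Qed.

Let posB f j : Num.max (f j) 0 - Num.max (- f j) 0 = f j.
Proof. by have [fj|fj] := leP (f j) 0; [rewrite max_l|rewrite max_r]; lra. Qed.

Let summable_pos f : rsummable f -> rsummable (fun j => Num.max (f j) 0).
Proof.
apply: le_lt_trans; apply: le_esum => j _.
by rewrite lee_fin ger0_norm// ge_max ler_norm normr_ge0.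
Qed.

Let summable_neg f : rsummable f -> rsummable (fun j => Num.max (- f j) 0).
Proof.
move=> sf; apply: (summable_pos (f := fun j => - f j)).
by move: sf; rewrite /rsummable; under [in X in _ -> X]eq_esum do rewrite normrN.
Qed.

Lemma rsumE f g h : (forall j, 0 <= g j) -> (forall j, 0 <= h j) ->
  rsummable g -> rsummable h -> (forall j, f j = g j - h j) ->
  rsum f = nsum g - nsum h.
Proof.
move=> g0 h0 sg sh fgh.
have sf : rsummable f.
  rewrite (_ : f = fun j => g j + -1 * h j).
    by apply: rsummableD => //; exact: rsummableZ.
  by apply/funext => j; rewrite mulN1r fgh.
have p0 := pos_ge0 f; have n0 := pos_ge0 (fun j => - f j).
have sp := summable_pos sf; have sn := summable_neg sf.
suff : nsum (fun j => Num.max (f j) 0) + nsum h =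
       nsum (fun j => Num.max (- f j) 0) + nsum g by rewrite /rsum; lra.
rewrite -!nsumD//; congr nsum; apply/funext => j.
by have := posB f j; rewrite [X in _ = X]fgh => ?; lra.
Qed.

Lemma rsum_ge0E f : (forall j, 0 <= f j) -> rsummable f -> rsum f = nsum f.
Proof.
move=> f0 sf; rewrite (@rsumE f f (fun=> 0))//.
- by rewrite [X in _ - X](_ : _ = 0) ?subr0// /nsum esum1.
- exact: rsummable0.
- by move=> j; rewrite subr0.
Qed.

Lemma rsum0 : rsum (fun=> 0) = 0.
Proof. by rewrite rsum_ge0E//; [rewrite /nsum esum1|exact: rsummable0]. Qed.

Lemma rsumD f g : rsummable f -> rsummable g ->
  rsum (fun j => f j + g j) = rsum f + rsum g.
Proof.
move=> sf sg.
have [sfp sfn] := (summable_pos sf, summable_neg sf).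
have [sgp sgn] := (summable_pos sg, summable_neg sg).
have [fp fn] := (pos_ge0 f, pos_ge0 (fun j => - f j)).
have [gp gn] := (pos_ge0 g, pos_ge0 (fun j => - g j)).
rewrite (@rsumE _ (fun j => Num.max (f j) 0 + Num.max (g j) 0)
  (fun j => Num.max (- f j) 0 + Num.max (- g j) 0)).
- by rewrite !nsumD// /rsum; lra.
- by move=> j; rewrite addr_ge0.
- by move=> j; rewrite addr_ge0.
- exact: rsummableD.
- exact: rsummableD.
- by move=> j; have := posB f j; have := posB g j; lra.
Qed.

Lemma rsumN f : rsum (fun j => - f j) = - rsum f.
Proof. by rewrite /rsum opprB; under [X in _ - nsum X]eq_fun do rewrite opprK. Qed.

Lemma rsumZ k f : rsummable f -> rsum (fun j => k * f j) = k * rsum f.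
Proof.
wlog k0 : k / 0 <= k => [hw|sf].
  have [/hw//|k0 sf] := leP 0 k.
  rewrite -[k]opprK mulNr -hw ?oppr_ge0 ?(ltW k0)// -rsumN.
  by congr rsum; apply/funext => j; rewrite mulNr.
have [fp fn] := (pos_ge0 f, pos_ge0 (fun j => - f j)).
rewrite (@rsumE _ (fun j => k * Num.max (f j) 0)
  (fun j => k * Num.max (- f j) 0)).
- by rewrite !nsumZ// /rsum mulrBr.
- by move=> j; rewrite mulr_ge0.
- by move=> j; rewrite mulr_ge0.
- exact/rsummableZ/summable_pos.
- exact/rsummableZ/summable_neg.
- by move=> j; rewrite -mulrBr posB.
Qed.

Definition csummable c := rsummable (fun j => complex.Re (c j)) /\
  rsummable (fun j => complex.Im (c j)).

Lemma csumP (k : R[i]) c d : csummable c -> csummable d ->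
  csum (fun j => k * c j + d j) = k * csum c + csum d.
Proof.
move=> [cr ci] [dr di]; case: k => a b; rewrite /csum.
have -> : (fun j => complex.Re ((a +i* b) * c j + d j)) =
    (fun j => (a * complex.Re (c j) + - b * complex.Im (c j)) + complex.Re (d j)).
  by apply/funext => j; case: (c j) (d j) => [x y] [z t] /=; rewrite mulNr.
have -> : (fun j => complex.Im ((a +i* b) * c j + d j)) =
    (fun j => (a * complex.Im (c j) + b * complex.Re (c j)) + complex.Im (d j)).
  by apply/funext => j; case: (c j) (d j) => [x y] [z t].
have s1 := rsummableZ a cr; have s2 := rsummableZ (- b) ci.
have s3 := rsummableZ a ci; have s4 := rsummableZ b cr.
rewrite (rsumD (rsummableD s1 s2) dr) (rsumD s1 s2) (rsumZ a cr) (rsumZ (- b) ci).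
rewrite (rsumD (rsummableD s3 s4) di) (rsumD s3 s4) (rsumZ a ci) (rsumZ b cr).
by rewrite mulNr.
Qed.

Lemma csum_conj c : csum (fun j => (c j)^*) = (csum c)^*.
Proof.
rewrite /csum /= -rsumN; congr (rsum _ +i* rsum _);
  by apply/funext => j; case: (c j).
Qed.

End sums.

Section ell2.
Variables (R : realType) (J : countType).

Definition square_summable : {pred J -> R[i]} :=
  [pred c | `[< (\esum_(j in [set: J]) (sqnorm (c j))%:E < +oo)%E >]].

Record ell2 := Ell2 {
  ell2_fun :> J -> R[i];
  ell2P : ell2_fun \in square_summable }.

HB.instance Definition _ := [isSub for ell2_fun].
HB.instance Definition _ := [Choice of ell2 by <:].

Lemma square_summableE (c : J -> R[i]) :
  (c \in square_summable) = `[< rsummable (fun j => sqnorm (c j)) >].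
Proof.
by rewrite inE; apply: asbool_equiv_eq; rewrite ge0_rsummableE// => j; exact: sqnorm_ge0.
Qed.

Lemma square_summable_submod : submod_closed square_summable.
Proof.
split=> [|k c d]; rewrite !square_summableE.
  apply/asboolP; rewrite (_ : (fun _ => _) = fun=> 0); first exact: rsummable0.
  by apply/funext => j; rewrite /sqnorm normr0 expr0n.
move=> /asboolP sc /asboolP sd; apply/asboolP.
apply: (@le_rsummable _ _ (fun j => (2 * sqnorm k) * sqnorm (c j) + 2 * sqnorm (d j))).
  move=> j; rewrite ger0_norm ?sqnorm_ge0// !sqnormC.
  change ((k *: c + d) j) with (k * c j + d j).
  case: k (c j) (d j) => [a b] [x y] [z t] /=.
  rewrite -subr_ge0.
  rewrite [X in 0 <= X](_ : _ = (a * x - b * y - z) ^+ 2 + (a * y + b * x - t) ^+ 2);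
    last by ring.
  by rewrite addr_ge0// sqr_ge0.
by apply: rsummableD; exact: rsummableZ.
Qed.

HB.instance Definition _ := GRing.isSubmodClosed.Build R[i] (J -> R[i])
  square_summable square_summable_submod.
HB.instance Definition _ := [SubChoice_isSubLmodule of ell2 by <:].

Implicit Types c d : ell2.

Lemma ell2_eqP c d : c =1 d -> c = d.
Proof. by move=> cd; apply: val_inj; exact/funext. Qed.

Definition ell2_dot c d : R[i] := csum (fun j => c j * Num.conj (d j)).

Lemma ell2_rsummable c : rsummable (fun j => sqnorm (c j)).
Proof. by have := ell2P c; rewrite square_summableE => /asboolP. Qed.

Lemma ell2_csummable c d : csummable (fun j => c j * Num.conj (d j)).
Proof.
have h := rsummableD (ell2_rsummable c) (ell2_rsummable d).
have amgm (a b x y : R) : `|a * x + b * y| <= a ^+ 2 + b ^+ 2 + (x ^+ 2 + y ^+ 2).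
  have p := addr_ge0 (sqr_ge0 (a + x)) (sqr_ge0 (b + y)).
  have q := addr_ge0 (sqr_ge0 (a - x)) (sqr_ge0 (b - y)).
  have r := addr_ge0 (addr_ge0 (sqr_ge0 a) (sqr_ge0 b))
                     (addr_ge0 (sqr_ge0 x) (sqr_ge0 y)).
  by rewrite ler_norml; apply/andP; split; lra.
split; apply: le_rsummable h => j; rewrite conjCE !sqnormC;
  case: (c j) (d j) => [a b] [x y] /=.
- by rewrite mulrN opprK.
- by rewrite mulrN addrC -mulrN (le_trans (amgm _ _ _ _))// sqrrN; lra.
Qed.

Lemma ell2_dotPl d : GRing.linear_for *%R (ell2_dot^~ d).
Proof.
move=> k c c' /=; rewrite /ell2_dot -csumP; [|exact: ell2_csummable..].
congr csum; apply/funext => j.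
by change ((k *: c + c') j) with (k * c j + c' j); rewrite mulrDl mulrA.
Qed.

Lemma ell2_dotC c d : ell2_dot c d = Num.conj (ell2_dot d c).
Proof.
rewrite /ell2_dot conjCE -csum_conj; congr csum; apply/funext => j.
by rewrite -conjCE rmorphM /= conjCK mulrC.
Qed.

Lemma ell2_dotPr c : GRing.linear_for (Num.conj \; *%R) (ell2_dot c).
Proof.
move=> k d d' /=; rewrite ell2_dotC ell2_dotPl rmorphD rmorphM /=.
by rewrite -!ell2_dotC.
Qed.

Lemma ell2_dotE c : ell2_dot c c = (nsum (fun j => sqnorm (c j)))%:C.
Proof.
rewrite /ell2_dot /csum -rsum_ge0E; first last.
- exact: ell2_rsummable.
- by move=> j; exact: sqnorm_ge0.
congr (_ +i* _); last first.
  rewrite -[RHS](@rsum0 R J); congr rsum; apply/funext => j.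
  by rewrite conjCE; case: (c j) => a b /=; ring.
congr rsum; apply/funext => j.
by rewrite sqnormC conjCE; case: (c j) => a b /=; ring.
Qed.

Lemma ell2_dot_gt0 c : c != 0 -> 0 < ell2_dot c c.
Proof.
move=> c0; rewrite ell2_dotE ltcR lt_def nsum_ge0 ?andbT; last first.
  by move=> j; exact: sqnorm_ge0.
apply: contra_neq c0 => nc0; apply: ell2_eqP => j.
have : sqnorm (c j) = 0.
  apply/eqP; rewrite eq_le sqnorm_ge0 andbT -lee_fin -nc0 nsumK; last 2 first.
  - by move=> i; exact: sqnorm_ge0.
  - exact: ell2_rsummable.
  apply: esum_ge; exists [set j]; first by split=> //; exact: finite_set1.
  by rewrite fsbig_set1.
move=> /(congr1 (real_complex R)); rewrite sqnormE => /eqP.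
by rewrite sqrf_eq0 normr_eq0 => /eqP.
Qed.

HB.instance Definition _ := @bilinear_isBilinear.Build R[i] ell2 ell2 R[i]
  ( *%R ) (Num.conj \; *%R) ell2_dot (ell2_dotPl, ell2_dotPr).

Fact ell2_dot_hermitian c d :
  ell2_dot c d = (-1) ^+ false * Num.conj (ell2_dot d c).
Proof. by rewrite expr0 mul1r -ell2_dotC. Qed.

HB.instance Definition _ := @isHermitianSesquilinear.Build R[i] ell2 false
  Num.conj ell2_dot ell2_dot_hermitian.

HB.instance Definition _ := @isDotProduct.Build R[i] ell2 ell2_dot ell2_dot_gt0.

Definition ell2_norm c : R[i] := sqrtC (ell2_dot c c).

Lemma ell2_normD c d : ell2_norm (c + d) <= ell2_norm c + ell2_norm d.
Proof. exact: dot_triangle. Qed.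

Lemma ell2_normZ k c : ell2_norm (k *: c) = `|k| * ell2_norm c.
Proof.
rewrite /ell2_norm dnormZ sqrtCM ?nnegrE ?exprn_ge0 ?dnorm_ge0//.
by rewrite sqrCK.
Qed.

Lemma ell2_norm_eq0 c : ell2_norm c = 0 -> c = 0.
Proof. by move/eqP; rewrite sqrt_dnorm_eq0 => /eqP. Qed.

HB.instance Definition _ := Lmodule_isNormed.Build R[i] ell2
  ell2_normD ell2_normZ ell2_norm_eq0.

Lemma ell2_sqr_norm c : `|c| ^+ 2 = ell2_dot c c.
Proof. exact: sqrtCK. Qed.

HB.instance Definition _ := NormedModule_isInnerProduct.Build R[i] ell2
  ell2_sqr_norm.

Lemma ell2_sqnorm c : sqnorm c = nsum (fun j => sqnorm (c j)).
Proof. by apply: complexI; rewrite sqnormE ell2_sqr_norm ell2_dotE. Qed.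

Lemma ell2_coord_le c j : sqnorm (c j) <= sqnorm c.
Proof.
rewrite ell2_sqnorm -lee_fin nsumK; last 2 first.
- by move=> i; exact: sqnorm_ge0.
- exact: ell2_rsummable.
apply: esum_ge; exists [set j]; first by split=> //; exact: finite_set1.
by rewrite fsbig_set1.
Qed.

Lemma ell2_complete (F : set_system ell2) :
  ProperFilter F -> cauchy F -> cvg F.
Proof.
move=> FF Fc.
have {}Fc (e : R) : 0 < e -> exists c, F [set d | sqnorm (c - d) < e ^+ 2].
  move=> e0; have /(cauchyP _).1/(_ e%:C) := Fc; rewrite ltcR => /(_ e0)[c Fc0].
  exists c; apply: filterS Fc0 => d; rewrite -ball_normE /ball_/=.
  by rewrite normr_ltE// ltW.
have Fcoord (p : R[i] -> R) j : (forall x y, p x - p y = p (x - y)) ->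
    (forall x, p x ^+ 2 <= sqnorm x) -> cvg ((fun c : ell2 => p (c j)) @ F).
  move=> pB p2; apply: R_complete; apply/cauchyP => e e0.
  have [c Fce] := Fc _ e0; exists (p (c j)).
  change (F [set d : ell2 | ball (p (c j)) e (p (d j))]).
  apply: filterS Fce => d /= cd; rewrite -ball_normE.
  change (`|p (c j) - p (d j)| < e); rewrite pB.
  rewrite -(@ltr_pXn2r _ 2)// ?nnegrE ?(ltW e0)// real_normK ?num_real//.
  by apply: le_lt_trans cd; rewrite (le_trans (p2 _))// (ell2_coord_le (c - d)).
have Fre j : cvg ((fun c : ell2 => complex.Re (c j)) @ F).
  by apply: Fcoord => [[a b] [c d]//|x]; rewrite sqnormC lerDl sqr_ge0.
have Fim j : cvg ((fun c : ell2 => complex.Im (c j)) @ F).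
  by apply: Fcoord => [[a b] [c d]//|x]; rewrite sqnormC lerDr sqr_ge0.
pose l j : R[i] := lim ((fun c : ell2 => complex.Re (c j)) @ F) +i*
                   lim ((fun c : ell2 => complex.Im (c j)) @ F).
have close (c : ell2) (e : R) : F [set d | sqnorm (c - d) < e ^+ 2] ->
    (\esum_(j in [set: J]) (sqnorm (c j - l j))%:E <= (e ^+ 2)%:E)%E.
  move=> Fce; apply: ge_ereal_sup => _ [A [finA _] <-].
  rewrite fsbig_finite//= sumEFin lee_fin.
  have Flim : (fun d : ell2 => \sum_(j <- fset_set A) sqnorm (c j - d j)) @ F -->
              \sum_(j <- fset_set A) sqnorm (c j - l j).
    elim: (enum_fset _) => [|j s IH].
      by rewrite big_nil; under eq_fun do rewrite big_nil; exact: cvg_cst.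
    rewrite big_cons; under eq_fun do rewrite big_cons.
    apply: cvgD IH; rewrite sqnormC; under eq_fun do rewrite sqnormC.
    have cB (x y : R[i]) : complex.Re (x - y) = complex.Re x - complex.Re y /\
        complex.Im (x - y) = complex.Im x - complex.Im y.
      by case: x y => [? ?] [].
    under eq_fun do rewrite (cB _ _).1 (cB _ _).2.
    rewrite (cB _ _).1 (cB _ _).2 !expr2; under eq_fun do rewrite !expr2.
    have Rcvg : (fun d : ell2 => complex.Re (c j) - complex.Re (d j)) @ F -->
        complex.Re (c j) - complex.Re (l j).
      by apply: cvgB; [exact: cvg_cst|exact: Fre].
    have Icvg : (fun d : ell2 => complex.Im (c j) - complex.Im (d j)) @ F -->
        complex.Im (c j) - complex.Im (l j).
      by apply: cvgB; [exact: cvg_cst|exact: Fim].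
    by apply: cvgD; apply: cvgM.
  rewrite -(cvg_lim _ Flim)//; apply: limr_le.
    by apply/cvg_ex; exists (\sum_(j <- fset_set A) sqnorm (c j - l j)).
  apply: filterS Fce => d /= /ltW; apply: le_trans.
  rewrite ell2_sqnorm -lee_fin nsumK; last 2 first.
  - by move=> i; exact: sqnorm_ge0.
  - exact: ell2_rsummable.
  apply: esum_ge; exists A => //; rewrite fsbig_finite//= sumEFin.
  exact: lexx.
have l2l : l \in square_summable.
  have [c /close ce] := Fc _ ltr01.
  have cl : (c : J -> R[i]) - l \in square_summable.
    by apply/asboolP; apply: le_lt_trans ce _; rewrite ltry.
  rewrite -[l](subKr (c : J -> R[i])); apply: (GRing.rpredB _ cl).
  exact: ell2P.
apply/cvg_ex; exists (Ell2 l2l); apply/cvg_ballP => eps.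
move=> eps0; have := eps0; rewrite -[eps](RRe_real (gtr0_real eps0)) ltcR.
set e := complex.Re eps => e0.
have e20 : 0 < e / 2 by rewrite divr_gt0.
have [c Fce] := Fc _ e20; apply: filterS (Fce) => d /= cd.
rewrite -ball_normE /ball_/= -(subrKA c).
apply: (le_lt_trans (ler_normD _ _)).
rewrite [e]splitr rmorphD/= ler_ltD//; last by rewrite normr_ltE// ltW.
rewrite distrC normr_leE ?(ltW e20)//.
rewrite ell2_sqnorm -lee_fin nsumK; last 2 first.
- by move=> i; exact: sqnorm_ge0.
- exact: ell2_rsummable.
exact: close Fce.
Qed.

HB.instance Definition _ := Uniform_isComplete.Build ell2 ell2_complete.

End ell2.

Section dimension.
Variables (K : fieldType) (V : lmodType K).
Implicit Types (A : set V) (n : nat).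

Definition has_dim A n := exists b : 'I_n -> V,
  (forall a : 'I_n -> K, \sum_i a i *: b i = 0 -> forall i, a i = 0) /\
  A = [set \sum_i a i *: b i | a in [set: 'I_n -> K]].

Definition finite_dim_subspace A := exists n, has_dim A n.

(* [None] when [A] is not a finite-dimensional subspace. *)
Definition subspace_dim A : option nat := xget None [set Some n | n in has_dim A].

Lemma has_dim_le A n m : has_dim A n -> has_dim A m -> (m <= n)%N.
Proof.
move=> [b [_ Ab]] [b' [b'free Ab']]; rewrite leqNgt; apply/negP => nm.
have Ab'i i : A (b' i).
  rewrite Ab'; exists (fun j => (j == i)%:R) => //.
  rewrite (bigD1 i)//= eqxx scale1r big1 ?addr0// => j /negbTE->.
  by rewrite scale0r.
have /choice[M bM] : forall i, exists c : 'I_n -> K, b' i = \sum_j c j *: b j.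
  by move=> i; have := Ab'i i; rewrite Ab => -[c _ <-]; exists c.
pose X := \matrix_(i < m, j < n) M i j.
have : kermx X != 0.
  rewrite -mxrank_eq0 mxrank_ker subn_eq0 -ltnNge.
  exact: leq_ltn_trans (rank_leq_col _) nm.
move=> /rowV0Pn[u /sub_kermxP uX]; rewrite -subr_eq0 subr0 => /eqP; apply.
apply/rowP => i; rewrite mxE; apply: (b'free (fun i => u 0 i)) i.
under eq_bigr => i _ do rewrite bM scaler_sumr.
rewrite exchange_big/= big1// => j _.
under eq_bigr do rewrite scalerA.
rewrite -scaler_suml; have /rowP/(_ j) := uX; rewrite !mxE => uXj.
rewrite [X in X *: _](_ : _ = 0) ?scale0r// -[RHS]uXj.
by apply: eq_bigr => i _; rewrite mxE.
Qed.

Lemma dimE A n : has_dim A n -> subspace_dim A = Some n.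
Proof.
move=> An; rewrite /subspace_dim; case: xgetP => [_ -> [m Am <-]|/(_ (Some n))].
  by congr Some; apply/eqP; rewrite eqn_leq !(has_dim_le An Am, has_dim_le Am An).
by case; exists n.
Qed.

End dimension.

Definition separable_space (T : topologicalType) :=
  exists2 D : set T, countable D & dense D.

Section operators.
Variables (R : realType) (U V : hilbertType R[i]).

(* The function 0 is a junk value: by Riesz' theorem, every bounded linear
   operator between Hilbert spaces has a (unique) adjoint. *)
Definition adjoint (W : U -> V) : V -> U :=
  xget (fun=> 0) [set W' | forall u v, inner (W u) v = inner u (W' v)].

Lemma adjoint_eq (W : U -> V) (W' : V -> U) :
  (forall u v, inner (W u) v = inner u (W' v)) -> adjoint W = W'.
Proof.
move=> WW'; rewrite /adjoint; case: xgetP => [X _ WX|/(_ W')//].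
apply/funext => v; apply/eqP; rewrite -subr_eq0.
rewrite -(@dnorm_eq0 _ _ (inner : {dot U for _})).
by rewrite linearBr/= -WX WW' subrr.
Qed.

End operators.

Section spectrum.
Variable R : realType.

Definition spectrum (H : hilbertType R[i]) (T : H -> H) : set R[i] :=
  ~` [set lam | exists S : {linear H -> H}, [/\ continuous S,
        cancel (fun h => T h - lam *: h) S
      & cancel S (fun h => T h - lam *: h)]].

Definition sigma2 (U V : hilbertType R[i]) (W : U -> V) : set R[i] :=
  spectrum (adjoint W \o W).

End spectrum.

Section frames.
Variables (R : realType) (H : hilbertType R[i]).

Definition Bessel (J : countType) (x : J -> H) := exists2 b : R, 0 < b &
  forall h, (\esum_(j in [set: J]) (sqnorm (inner h (x j)))%:E
             <= (b * sqnorm h)%:E)%E.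

Definition Parseval_frame (J : countType) (x : J -> H) (S : set H) :=
  (forall j, S (x j)) /\
  forall h, S h -> \esum_(j in [set: J]) (sqnorm (inner h (x j)))%:E
                   = (sqnorm h)%:E.

(* [insubd] is harmless when [x] is a Bessel sequence, see [analysisE]. *)
Definition analysis (J : countType) (x : J -> H) (h : H) : ell2 R J :=
  insubd 0 (fun j => inner h (x j)).

Lemma analysisE (J : countType) (x : J -> H) (h : H) (j : J) :
  Bessel x -> analysis x h j = inner h (x j).
Proof.
move=> [b _ xb]; rewrite /analysis insubdK//.
by apply/asboolP; apply: le_lt_trans (xb h) _; rewrite ltry.
Qed.

Definition cross_correlation (J I : countType) (x : J -> H) (y : I -> H) :
  ell2 R J -> ell2 R I := analysis y \o adjoint (analysis x).

Definition stable_on (I : countType) (A : H -> ell2 R I) (alpha beta : R)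
    (T : set H) := forall x1 x2, T x1 -> T x2 ->
  alpha * sqnorm (x1 - x2) <= sqnorm (A x1 - A x2) <= beta * sqnorm (x1 - x2).

Definition subspace_sum (S T : set H) : set H :=
  [set x + y | x in S & y in T].

End frames.

(* Main.v *)
(* Fix two indices, let T be the sum of the two subspaces and A the analysis
   operator of Psi. Stability on the union amounts to the bounds
   alpha |u|^2 <= |A u|^2 <= beta |u|^2 for u in every such T. Diagonalizing a
   Gram matrix gives an orthonormal basis e_k of T whose images A e_k are
   pairwise orthogonal, so that the bounds only have to be checked on the e_k.
   The analysis operator of a Parseval frame Phi of T is isometric on T and
   vanishes on its orthogonal complement; with f_k the (orthonormal) images of
   the e_k, the cross-correlation operator is thus
     G c = sum_k <c, f_k> A e_k,
   and G^* G is diagonal: G^* G c = sum_k |A e_k|^2 <c, f_k> f_k. Hence the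
   spectrum of G^* G contains the |A e_k|^2 and possibly 0, nothing else, and
   the range of G has full dimension iff no A e_k vanishes. *)
Require Import Defs.
From HB Require Import structures.
From mathcomp Require Import all_boot all_order all_algebra.
From mathcomp Require Import all_classical all_reals all_analysis.
From mathcomp Require Import sesquilinear spectral complex ring.

Set Implicit Arguments.
Unset Strict Implicit.
Unset Printing Implicit Defensive.

Import Order.TTheory GRing.Theory Num.Theory.
Import numFieldNormedType.Exports.

Local Open Scope classical_set_scope.
Local Open Scope ring_scope.
Local Open Scope complex_scope.

(** * Orthogonal families and their spans *)

Section inner_product.
Variables (C : numClosedFieldType) (V : innerProductType C).
Implicit Types (u v w : V).

Lemma innerC u v : inner u v = Num.conj (inner v u).
Proof. by rewrite hermC expr0 mul1r. Qed.

Lemma inner_suml n (a : 'I_n -> C) (v : 'I_n -> V) w :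
  inner (\sum_i a i *: v i) w = \sum_i a i * inner (v i) w.
Proof. by rewrite linear_sumlz; apply: eq_bigr => i _; rewrite linearZl_LR. Qed.

Lemma inner_sumr n (a : 'I_n -> C) (v : 'I_n -> V) w :
  inner w (\sum_i a i *: v i) = \sum_i Num.conj (a i) * inner w (v i).
Proof. by rewrite linear_sumr; apply: eq_bigr => i _; rewrite linearZr_LR. Qed.

Definition orthogonal_family n (v : 'I_n -> V) :=
  forall i j, i != j -> inner (v i) (v j) = 0.

Definition orthonormal_family n (v : 'I_n -> V) :=
  forall i j, inner (v i) (v j) = (i == j)%:R.

Lemma orthonormal_orthogonal n (v : 'I_n -> V) :
  orthonormal_family v -> orthogonal_family v.
Proof. by move=> vo i j /negbTE ij; rewrite vo ij. Qed.

Lemma inner_orthogonal_sum n (v : 'I_n -> V) (a : 'I_n -> C) k :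
  orthogonal_family v ->
  inner (\sum_i a i *: v i) (v k) = a k * inner (v k) (v k).
Proof.
move=> vo; rewrite inner_suml (bigD1 k)//= big1 ?addr0// => i ik.
by rewrite vo// mulr0.
Qed.

Lemma orthogonal_sum_sqr n (v : 'I_n -> V) (a : 'I_n -> C) :
  orthogonal_family v ->
  `|\sum_i a i *: v i| ^+ 2 = \sum_i `|a i| ^+ 2 * `|v i| ^+ 2.
Proof.
move=> vo; rewrite sqr_normr_inner inner_sumr; apply: eq_bigr => i _.
by rewrite inner_orthogonal_sum// mulrA -sqr_normr_inner normCK [Num.conj _ * _]mulrC.
Qed.

Lemma inner_orthonormal_sum n (v : 'I_n -> V) (a : 'I_n -> C) k :
  orthonormal_family v -> inner (\sum_i a i *: v i) (v k) = a k.
Proof.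
move=> vo; rewrite inner_orthogonal_sum; last exact: orthonormal_orthogonal.
by rewrite vo eqxx mulr1.
Qed.

(** Same shape as the set in [has_dim], but [v] may be linearly dependent. *)
Definition span_family n (v : 'I_n -> V) : set V :=
  [set \sum_i a i *: v i | a in [set: 'I_n -> C]].

Lemma sum_in_span n (v : 'I_n -> V) (a : 'I_n -> C) :
  span_family v (\sum_i a i *: v i).
Proof. by exists a. Qed.

Lemma family_in_span n (v : 'I_n -> V) i : span_family v (v i).
Proof.
exists (fun j => (j == i)%:R) => //.
rewrite (bigD1 i)//= eqxx scale1r big1 ?addr0// => j /negbTE->.
by rewrite scale0r.
Qed.

Lemma span_familyD n (v : 'I_n -> V) u w :
  span_family v u -> span_family v w -> span_family v (u + w).
Proof.
move=> [a _ <-] [b _ <-]; exists (fun i => a i + b i) => //.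
by rewrite -big_split; apply: eq_bigr => i _; rewrite scalerDl.
Qed.

Lemma span_familyZ n (v : 'I_n -> V) k u :
  span_family v u -> span_family v (k *: u).
Proof.
move=> [a _ <-]; exists (fun i => k * a i) => //.
by rewrite scaler_sumr; apply: eq_bigr => i _; rewrite scalerA.
Qed.

Lemma sub_span_family m n (v : 'I_m -> V) (w : 'I_n -> V) :
  (forall i, span_family w (v i)) -> span_family v `<=` span_family w.
Proof.
move=> vw _ [a _ <-]; apply: (big_ind (span_family w)).
- exists (fun=> 0) => //.
  by rewrite big1// => i _; rewrite scale0r.
- exact: span_familyD.
- by move=> i _; exact: span_familyZ.
Qed.

Lemma span_family_sum m n (v : 'I_m -> V) (w : 'I_n -> V) : exists u : 'I_(m + n) -> V,
  [set x + y | x in span_family v & y in span_family w] = span_family u.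
Proof.
exists (fun i => match fintype.split i with inl j => v j | inr j => w j end).
have spl (a : 'I_(m + n) -> C) :
    \sum_i a i *: match fintype.split i with inl j => v j | inr j => w j end =
    \sum_i a (lshift n i) *: v i + \sum_i a (rshift m i) *: w i.
  rewrite big_split_ord/=; congr (_ + _); apply: eq_bigr => i _.
    by rewrite (unsplitK (inl i)).
  by rewrite (unsplitK (inr i)).
apply/seteqP; split=> [_ [_ [a _ <-] [_ [b _ <-] <-]]|_ [a _ <-]].
  exists (fun i => match fintype.split i with inl j => a j | inr j => b j end) => //.
  rewrite spl; congr (_ + _); apply: eq_bigr => i _.
    by rewrite (unsplitK (inl i)).
  by rewrite (unsplitK (inr i)).
rewrite spl; exists (\sum_i a (lshift n i) *: v i); first exact: sum_in_span.
by exists (\sum_i a (rshift m i) *: w i) => //; exact: sum_in_span.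
Qed.

Lemma orthonormal_has_dim n (v : 'I_n -> V) :
  orthonormal_family v -> has_dim (span_family v) n.
Proof.
move=> vo; exists v; split=> // a a0 i.
by rewrite -(inner_orthonormal_sum a i vo) a0 linear0l.
Qed.

(** Discard the zero vectors and rescale the others. The index type counts the nonzero members, so
    the dimension of the span can be read off. *)
Lemma orthogonal_normalize n (v : 'I_n -> V) : orthogonal_family v ->
  exists e : 'I_#|[pred i | v i != 0]| -> V,
    orthonormal_family e /\ span_family e = span_family v.
Proof.
move=> vo; pose A := [pred i | v i != 0].
exists (fun k : 'I_#|A| => `|v (enum_val k)|^-1 *: v (enum_val k)); split.
  move=> k l; rewrite linearZl_LR/= linearZr_LR/=.
  have [<-|kl] := eqVneq k l; last first.
    by rewrite vo ?mulr0//; apply: contra_neq kl => /enum_val_inj.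
  have vk0 : `|v (enum_val k)| != 0 by rewrite normr_eq0; exact: (enum_valP k).
  rewrite -sqr_normr_inner (CrealP _) ?rpredV ?normr_real//.
  by rewrite expr2 mulKf// mulVf.
apply/seteqP; split; apply: sub_span_family => i.
  exact/span_familyZ/family_in_span.
have [vi0|vi0] := eqVneq (v i) 0.
  by exists (fun=> 0) => //; rewrite big1 ?vi0// => k _; rewrite scale0r.
have iA : i \in A by [].
have := family_in_span
  (fun k : 'I_#|A| => `|v (enum_val k)|^-1 *: v (enum_val k)) (enum_rank_in iA i).
move=> /(span_familyZ `|v i|); rewrite enum_rankK_in// scalerA divff ?normr_eq0//.
by rewrite scale1r.
Qed.

Lemma orthogonal_has_dim n (v : 'I_n -> V) : orthogonal_family v ->
  has_dim (span_family v) #|[pred i | v i != 0]|.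
Proof. by move=> /orthogonal_normalize[e [eo <-]]; exact: orthonormal_has_dim. Qed.

(* Diagonalize the Gram matrix of the family. *)
Lemma unitary_orthogonalize n (v : 'I_n -> V) : exists2 P : 'M[C]_n,
  P \is unitarymx & orthogonal_family (fun i => \sum_k P i k *: v k).
Proof.
pose M : 'M[C]_n := \matrix_(k, l) inner (v k) (v l).
have Mh : M \is hermsymmx.
  apply/is_hermitianmxP; rewrite expr0 scale1r; apply/matrixP => k l.
  by rewrite !mxE innerC.
exists (spectralmx M) => [|i j ij]; first exact: spectral_unitarymx.
have /orthomx_spectralP := hermitian_normalmx Mh.
set P := spectralmx M => MP.
have PU : P \is unitarymx by exact: spectral_unitarymx.
have : P *m M *m invmx P = diag_mx (spectral_diag M).
  rewrite {1}MP !mulmxA mulmxV ?unitarymx_unit// mul1mx.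
  by rewrite mulmxK ?unitarymx_unit.
(* The inverse of [P] is its conjugate transpose, so this off-diagonal entry is the inner product of
   the [i]-th and [j]-th combinations. *)
rewrite invmx_unitary// => /matrixP/(_ i j); rewrite [RHS]mxE (negbTE ij) mulr0n => <-.
rewrite inner_sumr mxE; apply: eq_bigr => l _; rewrite inner_suml !mxE mulrC.
by congr (_ * _); apply: eq_bigr => k _; rewrite !mxE.
Qed.

Lemma unitary_span n (v : 'I_n -> V) (P : 'M[C]_n) : P \is unitarymx ->
  span_family (fun i => \sum_k P i k *: v k) = span_family v.
Proof.
move=> PU; apply/seteqP; split; apply: sub_span_family => i.
  exact: sum_in_span.
exists (fun k => invmx P i k) => //.
under eq_bigr do rewrite scaler_sumr; rewrite exchange_big/=.
transitivity (\sum_k (invmx P *m P) i k *: v k).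
  apply: eq_bigr => k _; rewrite mxE scaler_suml.
  by apply: eq_bigr => l _; rewrite scalerA.
rewrite mulVmx ?unitarymx_unit// (bigD1 i)//= mxE eqxx scale1r.
by rewrite big1 ?addr0// => k /negbTE ki; rewrite mxE eq_sym ki scale0r.
Qed.

Lemma unitary_orthonormal n (v : 'I_n -> V) (P : 'M[C]_n) : P \is unitarymx ->
  orthonormal_family v -> orthonormal_family (fun i => \sum_k P i k *: v k).
Proof.
move=> /unitarymxP/matrixP PU vo i j; have := PU i j; rewrite !mxE => <-.
rewrite inner_sumr; apply: eq_bigr => l _.
by rewrite inner_orthonormal_sum// !mxE mulrC.
Qed.

Lemma orthonormal_basis n (v : 'I_n -> V) : exists m (e : 'I_m -> V),
  orthonormal_family e /\ span_family e = span_family v.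
Proof.
have [P PU /orthogonal_normalize[e [eo ev]]] := unitary_orthogonalize v.
by eexists; exists e; split; rewrite // ev unitary_span.
Qed.

End inner_product.

(** A singular value decomposition of [A] on the span: a unitary change of basis keeps an
    orthonormal basis orthonormal, and it is chosen to diagonalize the Gram matrix of the images. *)
Lemma orthonormal_basis_diagonalizing (C : numClosedFieldType)
    (V W : innerProductType C) (A : {linear V -> W}) n (v : 'I_n -> V) :
  exists m (e : 'I_m -> V), [/\ orthonormal_family e,
    span_family e = span_family v & orthogonal_family (A \o e)].
Proof.
have [m [e [eo ev]]] := orthonormal_basis v.
have [P PU AP] := unitary_orthogonalize (A \o e).
exists m, (fun i => \sum_k P i k *: e k); split.
- exact: unitary_orthonormal.
- by rewrite unitary_span.
- move=> i j ij.
  suff AE k : A (\sum_l P k l *: e l) = \sum_l P k l *: (A \o e) l.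
    by rewrite /= !AE; exact: AP.
  by rewrite linear_sum; apply: eq_bigr => l _; rewrite linearZ.
Qed.

(** * Operators diagonal in an orthonormal family *)

Section diagonal_operator.
Variables (C : numClosedFieldType) (V : innerProductType C) (n : nat).
Variables (f : 'I_n -> V) (fo : orthonormal_family f).
Implicit Types (a b : 'I_n -> C) (c : V).

Definition diag_op a c : V := \sum_k (a k * inner c (f k)) *: f k.

Lemma diag_op_linear a : linear (diag_op a).
Proof.
move=> k c c'; rewrite /diag_op scaler_sumr -big_split/=.
apply: eq_bigr => l _; rewrite linearDl/= linearZl_LR/= scalerA -scalerDl.
by rewrite mulrDr mulrCA.
Qed.

Lemma inner_normr_le c c' : `|inner c c'| <= `|c| * `|c'|.
Proof.
rewrite -(@ler_pXn2r _ 2)// ?nnegrE ?mulr_ge0// exprMn !sqr_normr_inner.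
exact: dot_CauchySchwarz.
Qed.

Lemma diag_op_bounded a c : `|diag_op a c| <= (\sum_k `|a k|) * `|c|.
Proof.
rewrite mulr_suml (le_trans (ler_norm_sum _ _ _))// ler_sum// => k _.
have fk : `|f k| = 1.
  by apply/eqP; rewrite -sqrp_eq1// sqr_normr_inner fo eqxx.
rewrite normrZ fk mulr1 normrM ler_wpM2l//.
by have := inner_normr_le c (f k); rewrite fk mulr1.
Qed.

(** The first operator multiplies [f k] by [x + a k] and the orthogonal complement of the family by
    [x]; the second one multiplies by the reciprocals. *)
Lemma scalar_diag_op_cancel (x y : C) a b : x * y = 1 ->
  (forall k, (x + a k) * (y + b k) = 1) ->
  cancel (fun c => x *: c + diag_op a c) (fun c => y *: c + diag_op b c).
Proof.
move=> xy1 xayb1 c; rewrite scalerDr scalerA mulrC xy1 scale1r -addrA.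
rewrite /diag_op scaler_sumr -big_split/= big1 ?addr0// => k _.
rewrite linearDl/= linearZl_LR/= inner_orthonormal_sum// scalerA -scalerDl.
rewrite -[RHS](scale0r (f k)); congr (_ *: _).
(* Cancelling [x * y = 1] leaves [x * b k + a k * y + a k * b k = 0]. *)
have := xayb1 k; rewrite mulrDl !mulrDr xy1 -!addrA -[RHS]addr0 => /addrI.
move=> /(congr1 ( *%R ^~ (inner c (f k)))); rewrite mul0r => <-.
ring.
Qed.

End diagonal_operator.

Lemma linear_normr_le_continuous (K : numFieldType) (V W : normedModType K)
    (A : {linear V -> W}) (M : K) :
  0 <= M -> (forall x, `|A x| <= M * `|x|) -> continuous A.
Proof.
move=> M0 AM; apply/linear_bounded_continuous/linear_boundedP.
exists M; split; first exact: ger0_real.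
by move=> r Mr x; rewrite (le_trans (AM x))// ler_wpM2r// ltW.
Qed.

(** * Adjoints and spectra of finite-rank operators *)

Section hilbert_operators.
Variable R : realType.

(** Taking the adjoint of a rank-one term exchanges its two vectors. Used for the analysis operator
    of a Parseval frame and for the cross-correlation operator. *)
Lemma adjoint_finite_rank (U V : hilbertType R[i]) n (f : 'I_n -> U)
    (g : 'I_n -> V) :
  adjoint (fun u => \sum_k inner u (f k) *: g k) =
  (fun v => \sum_k inner v (g k) *: f k).
Proof.
apply: adjoint_eq => u v; rewrite inner_suml inner_sumr.
by apply: eq_bigr => k _; rewrite -innerC mulrC.
Qed.

(** [f k] is an eigenvector: a linear left inverse of the shifted operator would send 0 to [f k]. *)
Lemma diag_in_spectrum (V : hilbertType R[i]) n (f : 'I_n -> V)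
    (d : 'I_n -> R[i]) k : orthonormal_family f -> spectrum (diag_op f d) (d k).
Proof.
move=> fo [T [_ TK _]]; have := TK (f k).
rewrite /diag_op (bigD1 k)//= fo eqxx mulr1 big1; last first.
  by move=> i ik; rewrite fo eq_sym (negbTE ik) mulr0 scale0r.
rewrite addr0 subrr linear0 => f0; have := fo k k.
by rewrite -f0 linear0l eqxx => /esym/eqP; rewrite oner_eq0.
Qed.

(** Away from 0 and the [d k] the resolvent is explicit: [(d k - lam)^-1] on [f k] and [- lam^-1] on
    the orthogonal complement. *)
Lemma spectrum_diag_op (V : hilbertType R[i]) n (f : 'I_n -> V)
    (d : 'I_n -> R[i]) : orthonormal_family f ->
  spectrum (diag_op f d) `<=` [set 0] `|` range d.
Proof.
move=> fo lam; apply: contraPP => /not_orP[/eqP lam0 dlam]; rewrite notK.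
have {}dlam k : d k - lam != 0.
  by rewrite subr_eq0; apply/eqP => dk; apply: dlam; exists k.
(* The correction that turns [- lam^-1] into [(d k - lam)^-1] along [f k]. *)
pose b k := (d k - lam)^-1 + lam^-1.
pose T c := - lam^-1 *: c + diag_op f b c.
have Tlin : linear T.
  move=> k c c'; rewrite /T diag_op_linear !scalerDr !scalerA [k * _]mulrC.
  by rewrite addrACA.
pose T' : {linear V -> V} := HB.pack T (GRing.isLinear.Build _ _ _ _ T Tlin).
have TE : (fun c => diag_op f d c - lam *: c) = (fun c => - lam *: c + diag_op f d c).
  by apply/funext => c; rewrite addrC scaleNr.
exists T'; rewrite TE; split.
- apply: (@linear_normr_le_continuous _ _ _ T' (`|lam^-1| + \sum_k `|b k|)).
    by rewrite addr_ge0// sumr_ge0.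
  move=> c; rewrite mulrDl (le_trans (ler_normD _ _))//.
  by rewrite lerD ?diag_op_bounded// normrZ normrN.
- apply: scalar_diag_op_cancel => // [|k]; first by rewrite mulrNN divff.
  by rewrite /b [- lam + _]addrC [- lam^-1 + _]addrC addrK mulfV.
- apply: scalar_diag_op_cancel => // [|k]; first by rewrite mulrNN mulVf.
  by rewrite /b [- lam + _]addrC [- lam^-1 + _]addrC addrK mulVf.
Qed.

End hilbert_operators.

(** * Isometries preserve inner products *)

Section isometry.
Variables (C : numClosedFieldType) (V W : innerProductType C) (A : {linear V -> W}).

(* Polarization: the sesquilinear defect is recovered from the sum [d + d^*]
   computed at [(u, v)] and at [('i u, v)]. *)
Lemma isometry_inner n (e : 'I_n -> V) :
  (forall u, span_family e u -> `|A u| = `|u|) ->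
  forall u v, span_family e u -> span_family e v ->
  inner (A u) (A v) = inner u v.
Proof.
move=> Aiso.
have re u v : span_family e u -> span_family e v ->
    inner (A u) (A v) + Num.conj (inner (A u) (A v)) =
    inner u v + Num.conj (inner u v).
  move=> eu ev; have := congr1 (fun z => z ^+ 2) (Aiso _ (span_familyD eu ev)).
  rewrite linearD !sqr_normr_inner !dnormD -!sqr_normr_inner !Aiso//.
  exact: addrI.
move=> u v eu ev; have := re _ _ (span_familyZ 'i eu) ev; have := re _ _ eu ev.
rewrite linearZ !linearZl_LR/= !rmorphM/= conjCi !mulNr -!mulrBr => r1.
move=> /(mulfI (neq0Ci _)) r2; apply: (@mulIf _ 2); first by rewrite pnatr_eq0.
rewrite !mulr_natr !mulr2n -{2}[inner (A u) (A v)](subrK (Num.conj (inner (A u) (A v)))).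
by rewrite r2 addrCA r1 addrCA subrK.
Qed.

Lemma isometry_orthonormal n (e : 'I_n -> V) :
  (forall u, span_family e u -> `|A u| = `|u|) ->
  orthonormal_family e -> orthonormal_family (A \o e).
Proof.
move=> Aiso eo i j; rewrite /= (isometry_inner Aiso) ?eo//;
  exact: family_in_span.
Qed.

End isometry.

(** * Orthogonal projection onto a span *)

Section projection.
Variables (C : numClosedFieldType) (V : innerProductType C) (n : nat).
Variables (e : 'I_n -> V) (eo : orthonormal_family e).

Definition proj_span u := \sum_k inner u (e k) *: e k.

Lemma inner_proj_span u v : span_family e v -> inner (proj_span u) v = inner u v.
Proof.
move=> [a _ <-]; rewrite !inner_sumr; apply: eq_bigr => k _.
by rewrite inner_orthonormal_sum.
Qed.

(** With [p] the projection, [|p|^2 = <u, p>] is at most [|u| |p|] by Cauchy-Schwarz; divide by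
    [|p|]. *)
Lemma normr_proj_span_le u : `|proj_span u| <= `|u|.
Proof.
have [->|p0] := eqVneq (proj_span u) 0; first by rewrite normr0.
rewrite -(@ler_pM2r _ `|proj_span u|) ?normr_gt0//.
rewrite -[leLHS]expr2 sqr_normr_inner inner_proj_span; last exact: sum_in_span.
(* In [C] a number is bounded by its modulus only if it is real; here it equals [<p, p>]. *)
by rewrite (le_trans (real_ler_norm _)) ?inner_normr_le//
  -inner_proj_span ?ger0_real ?dnorm_ge0//; exact: sum_in_span.
Qed.

End projection.

(** * Analysis operators of Bessel sequences *)

Section frames.
Variables (R : realType) (H : hilbertType R[i]).

Lemma sqnorm_normr (U V : normedZmodType R[i]) (u : U) (v : V) :
  sqnorm u = sqnorm v -> `|u| = `|v|.
Proof.
move=> /(congr1 (real_complex R)); rewrite !sqnormE => /eqP.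
by rewrite eqrXn2// => /eqP.
Qed.

Lemma sqnorm_orthogonal_sum (V : innerProductType R[i]) n (v : 'I_n -> V)
    (a : 'I_n -> R[i]) : orthogonal_family v ->
  sqnorm (\sum_i a i *: v i) = \sum_i sqnorm (a i) * sqnorm (v i).
Proof.
move=> vo; apply: complexI; rewrite sqnormE orthogonal_sum_sqr// rmorph_sum.
by apply: eq_bigr => i _; rewrite rmorphM/= !sqnormE.
Qed.

Lemma sqnorm_orthonormal (V : innerProductType R[i]) n (v : 'I_n -> V) i :
  orthonormal_family v -> sqnorm (v i) = 1.
Proof. by move=> vo; apply: complexI; rewrite sqnormE sqr_normr_inner vo eqxx. Qed.

Lemma analysis_linear (J : countType) (x : J -> H) :
  Bessel x -> linear (analysis x).
Proof.
move=> xB k u v; apply: ell2_eqP => j; rewrite analysisE//.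
change (inner (k *: u + v) (x j) = k * analysis x u j + analysis x v j).
by rewrite !analysisE// linearDl/= linearZl_LR.
Qed.

(** Linearity depends on the proof of [Bessel x], so the bundled map takes it as an argument. *)
Definition linear_analysis (J : countType) (x : J -> H) (xB : Bessel x) :
    {linear H -> ell2 R J} :=
  HB.pack (analysis x) (GRing.isLinear.Build _ _ _ _ _ (analysis_linear xB)).

Lemma sqnorm_analysis (J : countType) (x : J -> H) u : Bessel x ->
  (sqnorm (analysis x u))%:E = \esum_(j in [set: J]) (sqnorm (inner u (x j)))%:E.
Proof.
move=> xB; rewrite ell2_sqnorm nsumK; last 2 first.
- by move=> j; exact: sqnorm_ge0.
- exact: ell2_rsummable.
by apply: eq_esum => j _; rewrite analysisE.
Qed.

(** * Parseval frames and cross-correlation *)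

Section parseval.
Variables (J : countType) (x : J -> H) (n : nat) (e : 'I_n -> H).
Hypothesis eo : orthonormal_family e.
Hypothesis xP : Parseval_frame x (span_family e).

Let inner_proj u j : inner (proj_span e u) (x j) = inner u (x j).
Proof. by rewrite inner_proj_span//; exact: xP.1. Qed.

(** The frame vectors lie in the span, so [u] and its projection have the same coefficients; the
    Parseval identity for the projection gives the bound 1. *)
Lemma Parseval_Bessel : Bessel x.
Proof.
exists 1 => // u; under eq_esum do rewrite -inner_proj.
rewrite xP.2; last exact: sum_in_span.
rewrite lee_fin mul1r -lecR !sqnormE ler_pXn2r ?nnegrE//.
exact: normr_proj_span_le.
Qed.

Lemma Parseval_analysis_orthonormal : orthonormal_family (analysis x \o e).
Proof.
apply: (isometry_orthonormal (A := linear_analysis Parseval_Bessel)) => // u eu; apply: sqnorm_normr.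
apply: EFin_inj; rewrite [LHS]sqnorm_analysis; last exact: Parseval_Bessel.
exact: xP.2.
Qed.

(** Again only the projection of [u] matters. This finite-rank form makes the adjoint explicit. *)
Lemma Parseval_analysisE u :
  analysis x u = \sum_k inner u (e k) *: analysis x (e k).
Proof.
pose B := linear_analysis Parseval_Bessel; transitivity (B (proj_span e u)).
  by apply: ell2_eqP => j; rewrite !analysisE ?inner_proj//; exact: Parseval_Bessel.
by rewrite linear_sum; apply: eq_bigr => k _; rewrite linearZ.
Qed.

Variables (I : countType) (Psi : I -> H).
Hypothesis PsiB : Bessel Psi.

Lemma cross_correlationE : cross_correlation x Psi =
  (fun c => \sum_k inner c (analysis x (e k)) *: analysis Psi (e k)).
Proof.
pose A := linear_analysis PsiB.
have -> : cross_correlation x Psi =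
    analysis Psi \o (fun c => \sum_k inner c (analysis x (e k)) *: e k).
  by congr (_ \o _); rewrite -adjoint_finite_rank; congr adjoint;
    exact/funext/Parseval_analysisE.
apply/funext => c; change (A (\sum_k inner c (analysis x (e k)) *: e k) =
  \sum_k inner c (analysis x (e k)) *: A (e k)).
by rewrite linear_sum; apply: eq_bigr => k _; rewrite linearZ.
Qed.

Lemma range_cross_correlation :
  range (cross_correlation x Psi) = span_family (analysis Psi \o e).
Proof.
rewrite cross_correlationE; apply/seteqP; split=> [_ [c _ <-]|_ [a _ <-]].
  exact: sum_in_span.
(* By orthonormality of [analysis x \o e], the coefficients of this vector are the [a k]. *)
exists (\sum_k a k *: (analysis x \o e) k) => //; apply: eq_bigr => k _.
by rewrite inner_orthonormal_sum//; exact: Parseval_analysis_orthonormal.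
Qed.

(** The adjoint pairs the image of [c] with each [analysis Psi (e k)]; orthogonality keeps only the
    [k]-th term. *)
Lemma cross_correlation_gram : orthogonal_family (analysis Psi \o e) ->
  adjoint (cross_correlation x Psi) \o cross_correlation x Psi =
  diag_op (analysis x \o e) (fun k => (sqnorm (analysis Psi (e k)))%:C).
Proof.
move=> go; rewrite cross_correlationE adjoint_finite_rank; apply/funext => c /=.
rewrite /diag_op; apply: eq_bigr => k _; congr (_ *: _).
rewrite (inner_orthogonal_sum (v := analysis Psi \o e))//=.
by rewrite sqnormE sqr_normr_inner mulrC.
Qed.

End parseval.
End frames.

(** * Stability bounds and the spectrum *)

Section stability.
Variables (R : realType) (H : hilbertType R[i]).

(** By Pythagoras the squared norms of [u] and [A u] are sums of the [sqnorm (a k)] with weights 1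
    and [sqnorm (A (e k))], so the bounds compare termwise. *)
Lemma bounds_orthonormal (V : innerProductType R[i]) (A : {linear H -> V})
    (alpha beta : R) n (e : 'I_n -> H) :
  orthonormal_family e -> orthogonal_family (A \o e) ->
  (forall u, span_family e u ->
     alpha * sqnorm u <= sqnorm (A u) <= beta * sqnorm u) <->
  (forall k, alpha <= sqnorm (A (e k)) <= beta).
Proof.
move=> eo go; split=> [Ab k|Ab _ [a _ <-]].
  by have := Ab _ (family_in_span e k); rewrite (sqnorm_orthonormal _ eo) !mulr1.
rewrite linear_sum; under [\sum_i A _]eq_bigr do rewrite linearZ/=.
rewrite (sqnorm_orthogonal_sum _ go) (sqnorm_orthogonal_sum _ (orthonormal_orthogonal eo)).
rewrite !mulr_sumr; apply/andP; split; apply: ler_sum => k _;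
  rewrite (sqnorm_orthonormal _ eo) mulr1 [_ * sqnorm (a k)]mulrC;
  by rewrite ler_wpM2l ?sqnorm_ge0//; case/andP: (Ab k).
Qed.

Lemma bounds_on_span_iff (I J : countType) (Psi : I -> H) (x : J -> H) m
    (v : 'I_m -> H) (alpha beta : R) : 0 < alpha -> Bessel Psi ->
  Parseval_frame x (span_family v) ->
  (forall u, span_family v u ->
     alpha * sqnorm u <= sqnorm (analysis Psi u) <= beta * sqnorm u) <->
  subspace_dim (range (cross_correlation x Psi)) = subspace_dim (span_family v) /\
  sigma2 (cross_correlation x Psi) `<=`
     [set 0] `|` [set x%:C | x in `[alpha, beta]%classic].
Proof.
move=> alpha0 PsiB.
pose A := linear_analysis PsiB.
(* In the basis [e] both sides become statements about the numbers [sqnorm (A (e k))]. *)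
have [n [e [eo <- go]]] := orthonormal_basis_diagonalizing A v => xP.
rewrite (bounds_orthonormal (A := A) alpha beta eo go) (range_cross_correlation eo xP PsiB).
rewrite (dimE (orthogonal_has_dim go)) (dimE (orthonormal_has_dim eo)).
rewrite /sigma2 (cross_correlation_gram eo xP PsiB go).
have fo := Parseval_analysis_orthonormal eo xP.
split=> [Ab|[[dim] sub] k].
  split=> [|lam /(spectrum_diag_op fo)[|[k _ <-]]]; [|by left|right].
    congr Some; rewrite -[RHS]card_ord; apply: eq_card => k; rewrite !inE.
    (* Since [alpha > 0], no image of a basis vector vanishes. *)
    have /andP[+ _] := Ab k; apply: contraTneq => /= ->.
    by rewrite -ltNge /sqnorm normr0 expr0n.
  by exists (sqnorm (A (e k))) => //=; rewrite in_itv/=; exact: Ab.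
(* Equal dimensions mean that the nonzero images are as many as the basis vectors. *)
have Aek0 : A (e k) != 0.
  have full : #|[pred k | (A \o e) k != 0]| = #|'I_n| by rewrite dim card_ord.
  suff /(_ k) : [pred k | (A \o e) k != 0] =i 'I_n by rewrite !inE.
  by apply/(subset_cardP full)/subset_predT.
(* This eigenvalue is nonzero, so it lies in the interval. *)
have [|[y]] := sub _ (diag_in_spectrum (d := fun k => (sqnorm (A (e k)))%:C) (k := k) fo).
  rewrite sqnormE => /eqP; rewrite sqrf_eq0 normr_eq0 => /eqP Ae0.
  by rewrite Ae0 eqxx in Aek0.
by rewrite /= in_itv/= => yab /complexI <-.
Qed.

End stability.

Theorem theorem4p7 (R : realType) (H : hilbertType R[i])
    (sepH : separable_space H)
    (Gamma : Type) (S : Gamma -> set H)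
    (finS : forall g, finite_dim_subspace (S g))
    (I : countType) (Psi : I -> H) (besselPsi : Bessel Psi)
    (J : Gamma -> Gamma -> countType)
    (Phi : forall g t : Gamma, J g t -> H)
    (frPhi : forall g t, Parseval_frame (Phi g t) (subspace_sum (S g) (S t)))
    (alpha beta : R) (alpha_gt0 : 0 < alpha) (le_alpha_beta : alpha <= beta) :
  stable_on (analysis Psi) alpha beta (\bigcup_g S g) <->
  (forall g t, subspace_dim (range (cross_correlation (Phi g t) Psi))
               = subspace_dim (subspace_sum (S g) (S t))) /\
  (forall g t, sigma2 (cross_correlation (Phi g t) Psi) `<=`
     [set 0] `|` [set x%:C | x in `[alpha, beta]%classic]).
Proof.
have iff_pair g t : (forall u, subspace_sum (S g) (S t) u ->
      alpha * sqnorm u <= sqnorm (analysis Psi u) <= beta * sqnorm u) <->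
    subspace_dim (range (cross_correlation (Phi g t) Psi)) =
      subspace_dim (subspace_sum (S g) (S t)) /\
    sigma2 (cross_correlation (Phi g t) Psi) `<=`
     [set 0] `|` [set x%:C | x in `[alpha, beta]%classic].
  have [m [b [_ Sg]]] := finS g; have [n [c [_ St]]] := finS t.
  have [v Sgt] := span_family_sum b c.
  have {}Sgt : subspace_sum (S g) (S t) = span_family v by rewrite -Sgt Sg St.
  by have := frPhi g t; rewrite Sgt => xP; exact: bounds_on_span_iff.
(* Closure under negation lets sums in [subspace_sum (S g) (S t)] be read as differences of points
   of the union. *)
have SN t y : S t y -> S t (- y).
  have [n [c [_ ->]]] := finS t; rewrite -scaleN1r; exact: span_familyZ.
pose A := linear_analysis besselPsi.
split=> [stab|[dimG sigG] x1 x2 [g _ Sg] [t _ St]]; last first.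
  rewrite -(linearB A x1 x2); apply: (iff_pair g t).2; first by split.
  by exists x1 => //; exists (- x2) => //; exact: SN.
suff Ab g t : forall u, subspace_sum (S g) (S t) u ->
      alpha * sqnorm u <= sqnorm (analysis Psi u) <= beta * sqnorm u.
  by split=> g t; have [] := (iff_pair g t).1 (Ab g t).
move=> _ [x1 Sg [x2 St <-]].
have := stab x1 (- x2); rewrite -(linearB A x1 (- x2)) opprK; apply.
  by exists g.
by exists t => //; exact: SN.
Qed.
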